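(* In the contention game with $k=2$ channels under acknowledgement-based feedback, consider any anonymous, memoryless protocol with the property that $\Pr\{X_{i,t}=0\}=0$ for every $t\ge 1$ (i.e., a pending player never stays idle). If the number of players is $n>4$, then no such protocol is an equilibrium protocol.
   Context: Contention game: $n$ players, channel set $K=\{1,\dots,k\}$, discrete time slots $t=1,2,\dots$. Each player has one packet; initially all players are pending. In each slot a pending player chooses (possibly at random) an action in $A=\{0,1,\dots,k\}$, where $0$ means no transmission and $a\in K$ means transmitting on channel $a$; $X_{i,t}$ denotes player $i$'s action at slot $t$. If exactly one player transmits on a channel in a slot, she succeeds and leaves the game; if two or more transmit on the same channel they collide and remain pending. A protocol is a sequence of decision rules giving, for each slot, a probability distribution on $A$ as a function of the player's available information. Latency $T_i$ = slot of player $i$'s successful transmission; players minimize expected latency. Acknowledgement-based feedback: only a player who attempted transmission learns whether she succeeded; decision rules depend only on the personal history $(X_{i,1},\dots,X_{i,t-1})$. Memoryless: the decision rule at slot $t$ does not depend on the personal history. Anonymous: all players use the same protocol, independent of identity. Equilibrium protocol: the profile in which all players use it is such that no player, at any slot and after any history, can decrease her (conditional) expected latency by unilaterally deviating. *)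

(* Defs.v *)
From HB Require Import structures.
From mathcomp Require Import all_boot all_order all_algebra.
From mathcomp Require Import all_classical all_reals.
From mathcomp Require Import ereal topology normedtype sequences.
Set Implicit Arguments. Unset Strict Implicit. Unset Printing Implicit Defensive.
Import Order.TTheory GRing.Theory Num.Theory.
Local Open Scope ring_scope.

(* Contention game with k = 2 channels.
   Actions: 'I_3, where ord0 = no transmission, 1 = channel 1, 2 = channel 2.
   Players: 'I_n.  Slots are numbered t = 1, 2, ...                          *)
Definition action := 'I_3.
Definition idle : action := ord0.

Section Game.
Variables (R : realType) (n : nat).

Definition is_dist (d : {ffun action -> R}) : Prop :=
  (forall a, 0 <= d a) /\ \sum_a d a = 1.

(* An anonymous memoryless protocol: for each slot t, the distribution of
   the action of a pending player at slot t (the same for every player and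
   independent of the personal history).  Only t >= 1 is meaningful. *)
Definition mprotocol := nat -> {ffun action -> R}.

(* A general (acknowledgement-based) strategy of a single player: a decision
   rule mapping the personal history (X_{i,1},...,X_{i,t-1}) (a list of length
   t-1) to a distribution on actions at slot t. *)
Definition strategy := seq action -> {ffun action -> R}.

Definition proto_strategy (q : mprotocol) : strategy :=
  fun hist => q (size hist).+1.

Definition succeeds (x : {ffun 'I_n -> action}) (j : 'I_n) : bool :=
  (x j != idle) && [forall k, (k != j) ==> (x k != x j)].

Definition next_pending (P : {set 'I_n}) (x : {ffun 'I_n -> action}) :=
  [set j in P | ~~ succeeds x j].

Definition profile_prob (i : 'I_n) (P : {set 'I_n}) (a : action)
    (d : {ffun action -> R}) (x : {ffun 'I_n -> action}) : R :=
  \prod_(j : 'I_n)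
     (if j == i then (x j == a)%:R
      else if j \in P then d (x j) else (x j == idle)%:R).

(* A weight w : {set 'I_n} -> R is a sub-probability on pending sets; the
   relevant mass is that of pending sets containing i (player i pending).
   One slot t, with player i playing a, others following the distribution
   q t: *)
Definition step (q : mprotocol) (i : 'I_n) (t : nat) (a : action)
    (w : {set 'I_n} -> R) : {set 'I_n} -> R :=
  fun P' => \sum_(P : {set 'I_n} | i \in P)
              w P * \sum_(x : {ffun 'I_n -> action} | next_pending P x == P')
                       profile_prob i P a (q t) x.

Definition pend_mass (i : 'I_n) (w : {set 'I_n} -> R) : R :=
  \sum_(P : {set 'I_n} | i \in P) w P.

Definition init_weight : {set 'I_n} -> R := fun P => (P == [set: 'I_n])%:R.

(* joint weight of (pending set at the start of slot (size h).+1, player i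
   pending) given that player i's actions in slots 1..size h were h *)
Fixpoint fixw (q : mprotocol) (i : 'I_n) (t : nat) (w : {set 'I_n} -> R)
    (h : seq action) : {set 'I_n} -> R :=
  match h with
  | [::] => w
  | a :: h' => fixw q i t.+1 (step q i t a w) h'
  end.

Definition hist_weight (q : mprotocol) (i : 'I_n) (h : seq action) :=
  fixw q i 1 init_weight h.

(* joint probability that player i is still pending s slots later, when at
   the start of slot (size hist).+1 her history is hist, the weight is w, and
   from then on she follows sigma while the others follow q *)
Fixpoint surv (q : mprotocol) (i : 'I_n) (sigma : strategy) (s : nat)
    (hist : seq action) (w : {set 'I_n} -> R) : R :=
  match s with
  | 0 => pend_mass i w
  | s'.+1 => \sum_(a : action)
               sigma hist a *
               surv q i sigma s' (rcons hist a) (step q i (size hist).+1 a w)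
  end.

Local Open Scope ereal_scope.

(* conditional expected latency E[T_i | personal history h, i pending at slot
   (size h).+1], when from slot (size h).+1 on player i uses sigma and all
   other players use the protocol q.  Using E[T] = sum_{u>=0} P(T > u) and
   P(T > u) = 1 for u < size h.  May be +oo. *)
Definition cond_latency (q : mprotocol) (i : 'I_n) (sigma : strategy)
    (h : seq action) : \bar R :=
  let w := hist_weight q i h in
  (size h)%:R%:E +
  \sum_(s <oo) ((surv q i sigma s h w / pend_mass i w)%R)%:E.

Definition equilibrium (q : mprotocol) : Prop :=
  forall (i : 'I_n) (h : seq action),
    (0 < pend_mass i (hist_weight q i h))%R ->
    forall sigma' : strategy, (forall hist, is_dist (sigma' hist)) ->
      cond_latency q i (proto_strategy q) h <= cond_latency q i sigma' h.

End Game.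

(* Main.v *)
(** A pending player's belief about the number m of pending players is a vector
    w_h, and one slot acts on it linearly. Equilibrium forces both channels to be
    used with positive probability in every slot (otherwise the unused one is
    a sure success), and bounds all latencies (always using the channel that the
    others favour less succeeds at a geometric rate). Hence after every history
    both channels are optimal, and staying idle for one slot is not better.
    The vectors w_h over all histories of a given length, including those with
    idle slots, span enough coordinates to turn the indifference into an identity
    for each m; with idling not being profitable, this forces both channels to
    have probability 1/2 in every slot. The latency with m >= 2 pending players
    is then 2^m / m, and for n > 4 staying idle in slot 1 is strictly better
    than transmitting. *)
Require Import Defs.
From HB Require Import structures.
From mathcomp Require Import all_boot all_order all_algebra.
From mathcomp Require Import all_classical all_reals.
From mathcomp Require Import ereal topology normedtype sequences.
From mathcomp Require Import ring lra zify.
Set Implicit Arguments. Unset Strict Implicit. Unset Printing Implicit Defensive.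
Import Order.TTheory GRing.Theory Num.Theory.
Import numFieldNormedType.Exports.
Local Open Scope ring_scope.

(** * Channels and the one-slot operator *)

Definition ch1 : action := @Ordinal 3 1 isT.
Definition ch2 : action := @Ordinal 3 2 isT.

Lemma action_cases (a : action) : [\/ a = idle, a = ch1 | a = ch2].
Proof.
case: a => [[|[|[|//]]] ha]; [apply: Or31|apply: Or32|apply: Or33]; exact: val_inj.
Qed.

Lemma sum_action (R : nmodType) (F : action -> R) :
  \sum_a F a = F idle + (F ch1 + F ch2).
Proof.
rewrite !big_ord_recl big_ord0 addr0.
by congr (_ + (F _ + F _)); apply: val_inj.
Qed.

(** [n1] and [n2] are the loads of the two channels, the distinguished player included. A load of
    exactly 1 removes one player. The leading factor vanishes when that player is the distinguished
    one. *)
Definition slot_value {R : realType} (f : nat -> R) (a : action) (m k : nat) : R :=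
  let n1 := (k + (a == ch1))%N in
  let n2 := (m.-1 - k + (a == ch2))%N in
  (~~ ((a == ch1) && (n1 == 1)%N || (a == ch2) && (n2 == 1)%N))%:R
  * f (m - (n1 == 1) - (n2 == 1))%N.

(* Expectation of [f (number of pending players)] (set to 0 once the
   distinguished player has succeeded) after a slot in which the distinguished
   player plays [a] and the [m.-1] others choose channels 1 and 2 with
   probabilities [p] and [q]; [k] counts the others on channel 1. *)
Definition slot_op {R : realType} (a : action) (p q : R) (f : nat -> R) (m : nat) : R :=
  \sum_(k < m) (p ^+ k * q ^+ (m.-1 - k) * slot_value f a m k) *+ 'C(m.-1, k).

(** * From action profiles to numbers of players per channel *)

Lemma succeedsE {n : nat} (x : {ffun 'I_n -> action}) (j : 'I_n) :
  succeeds x j = (x j != idle) && (#|[set k : 'I_n | x k == x j]| == 1)%N.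
Proof.
rewrite /succeeds; congr (_ && _); apply/forallP/cards1P.
- move=> h; exists j; apply/setP => k; rewrite !inE.
  by have [->|kj] := eqVneq k j; [rewrite eqxx|have := h k; rewrite kj /= => /negbTE].
- move=> [y /setP e] k; apply/implyP; apply: contra => xk.
  have /eqP -> : k == y by have := e k; rewrite !inE xk.
  by have := e j; rewrite !inE eqxx => /esym/eqP ->.
Qed.

Section SlotExpectation.
Variables (R : realType) (n : nat) (i : 'I_n) (P : {set 'I_n}) (a : action).
Hypothesis iP : i \in P.

(** Pending players never idle, so a profile of positive probability is determined by the set [S] of
    other pending players on channel 1. *)
Let split_profile (S : {set 'I_n}) : {ffun 'I_n -> action} :=
  [ffun j => if j == i then a
             else if j \in P then (if j \in S then ch1 else ch2) else idle].
Let on_ch1 (x : {ffun 'I_n -> action}) : {set 'I_n} :=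
  [set j : 'I_n in P :\ i | x j == ch1].

Let card_ch1 (S : {set 'I_n}) : S \subset P :\ i ->
  #|[set k : 'I_n | split_profile S k == ch1]| = (#|S| + (a == ch1))%N.
Proof.
move=> /fintype.subsetP sS; rewrite (cardsD1 i) !inE ffunE eqxx addnC; congr (_ + _)%N.
apply: eq_card => k; rewrite !inE ffunE.
case: (eqVneq k i) => [->|ki] /=.
  by apply/esym/negbTE/negP => /sS; rewrite !inE eqxx.
case: ifP => kP; first by case: ifP.
by apply/esym/negbTE/negP => /sS; rewrite !inE kP andbF.
Qed.

Let card_ch2 (S : {set 'I_n}) : S \subset P :\ i ->
  #|[set k : 'I_n | split_profile S k == ch2]| = (#|P|.-1 - #|S| + (a == ch2))%N.
Proof.
move=> sS; rewrite (cardsD1 i) !inE ffunE eqxx addnC; congr (_ + _)%N.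
have -> : #|P|.-1 = #|P :\ i| by rewrite (cardsD1 i P) iP.
have {2}-> : S = (P :\ i) :&: S by rewrite (finset.setIidPr sS).
rewrite -cardsD; apply: eq_card => k; rewrite !inE ffunE.
case: (eqVneq k i) => [->|ki] /=; first by rewrite andbF.
case: ifP => kP; first by rewrite andbT; case: ifP.
by rewrite andbF.
Qed.

Let succeeds_split (S : {set 'I_n}) j : S \subset P :\ i ->
  succeeds (split_profile S) j =
    (split_profile S j == ch1) && (#|S| + (a == ch1) == 1)%N
 || (split_profile S j == ch2) && (#|P|.-1 - #|S| + (a == ch2) == 1)%N.
Proof.
move=> sS; rewrite succeedsE.
case: (action_cases (split_profile S j)) => ->; rewrite ?andbF //=.
  by rewrite card_ch1 // orbF.
by rewrite card_ch2.
Qed.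

Let card_next (S : {set 'I_n}) : S \subset P :\ i ->
  #|next_pending P (split_profile S)| =
  (#|P| - (#|S| + (a == ch1) == 1) - (#|P|.-1 - #|S| + (a == ch2) == 1))%N.
Proof.
move=> sS.
pose C c : {set 'I_n} := [set k : 'I_n | split_profile S k == c].
pose D (b : bool) c : {set 'I_n} := if b then C c else finset.set0.
set b1 := (#|S| + (a == ch1) == 1)%N; set b2 := (#|P|.-1 - #|S| + (a == ch2) == 1)%N.
have -> : next_pending P (split_profile S) = (P :\: D b1 ch1) :\: D b2 ch2.
  apply/setP => k; rewrite !inE succeeds_split // -/b1 -/b2 negb_or.
  have kD b c : (k \in D b c) = (split_profile S k == c) && b.
    by rewrite /D; case: b; rewrite !inE ?andbT ?andbF.
  by rewrite !kD; case: (_ && b1); case: (_ && b2); case: (k \in P).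
have CP c : c != idle -> C c \subset P.
  move=> c0; apply/fintype.subsetP => k; rewrite !inE ffunE.
  case: (eqVneq k i) => [->//|_]; case: ifP => // _ /eqP e.
  by rewrite -e eqxx in c0.
have cD1 : #|D b1 ch1| = b1.
  rewrite /D /b1; case: eqP => [e|_]; last by rewrite cards0.
  by rewrite /C card_ch1.
have cD2 : #|D b2 ch2| = b2.
  rewrite /D /b2; case: eqP => [e|_]; last by rewrite cards0.
  by rewrite /C card_ch2.
have DP b c : c != idle -> D b c \subset P.
  by rewrite /D; case: b => [/CP//|_]; exact: finset.sub0set.
rewrite !cardsD (finset.setIidPr _) ?DP // cD1.
rewrite (finset.setIidPr _) ?cD2 //.
apply/fintype.subsetP => k kD; rewrite inE (fintype.subsetP (DP b2 ch2 _)) // andbT.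
move: kD; rewrite /D; case: (b1); case: (b2); rewrite !inE //.
by move=> /eqP ->.
Qed.

Let mem_next (S : {set 'I_n}) : S \subset P :\ i ->
  i \in next_pending P (split_profile S) =
  ~~ ((a == ch1) && (#|S| + (a == ch1) == 1)%N
      || (a == ch2) && (#|P|.-1 - #|S| + (a == ch2) == 1)%N).
Proof. by move=> sS; rewrite inE iP succeeds_split // ffunE eqxx. Qed.

Lemma slot_expectation (d : {ffun action -> R}) (f : nat -> R) : d idle = 0 ->
  \sum_(x | i \in next_pending P x)
     profile_prob i P a d x * f #|next_pending P x|
  = slot_op a (d ch1) (d ch2) f #|P|.
Proof.
move=> d0.
(* Any profile not of the form [split_profile S] has a zero factor: [i] does not play [a], a pending
   player idles, or a departed one transmits. *)
rewrite (bigID [pred x | split_profile (on_ch1 x) == x]) /= [X in _ + X]big1 ?addr0; last first.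
  move=> x /andP[_ /eqP nx]; suff -> : profile_prob i P a d x = 0 by rewrite mul0r.
  apply/eqP; apply/negPn/negP => /prodf_neq0 h; apply: nx.
  apply/ffunP => j; rewrite ffunE; have := h j isT.
  case: (eqVneq j i) => [->|ji].
    by case: (eqVneq (x i) a) => [->|]; rewrite ?eqxx.
  rewrite !inE ji /=; case: ifP => jP /=; last by case: (eqVneq (x j) idle) => [->|]; rewrite ?eqxx.
  by case: (action_cases (x j)) => -> //; rewrite d0 eqxx.
rewrite (reindex_onto split_profile on_ch1) /=; last by move=> x /andP[_ /eqP].
have inv (S : {set 'I_n}) : (on_ch1 (split_profile S) == S) = (S \subset P :\ i).
  apply/eqP/idP => [<-|sS].
    by apply/fintype.subsetP => k; rewrite inE => /andP[].
  apply/setP => k; rewrite !inE ffunE.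
  case: (eqVneq k i) => [->|ki] /=.
    by apply/esym/negbTE/negP => /(fintype.subsetP sS); rewrite !inE eqxx.
  case: ifP => kP /=; first by case: ifP.
  by apply/esym/negbTE/negP => /(fintype.subsetP sS); rewrite !inE kP andbF.
pose F k := d ch1 ^+ k * d ch2 ^+ (#|P|.-1 - k) * slot_value f a #|P| k.
have cPi : #|P :\ i| = #|P|.-1 by rewrite (cardsD1 i P) iP.
transitivity (\sum_(S : {set 'I_n} | S \subset P :\ i) F #|S|).
  rewrite big_mkcond [RHS]big_mkcond; apply: eq_bigr => S _.
  rewrite inv; case: ifP => [/andP[/andP[h1 h2] sS]|].
    rewrite sS; rewrite mem_next // in h1.
    rewrite /F /slot_value h1 mul1r card_next //; congr (_ * _).
    rewrite /profile_prob (bigD1 i) //= ffunE !eqxx mul1r.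
    rewrite (bigID (mem (P :\ i))) /= [X in _ * X]big1 ?mulr1; last first.
      move=> j; rewrite !inE => /andP[ji]; rewrite ji /= => jP.
      by rewrite ffunE (negbTE ji) (negbTE jP) eqxx.
    have -> : (#|P|.-1 - #|S|)%N = #|P :\ i :\: S|.
      by rewrite cardsD (finset.setIidPr sS) cPi.
    rewrite (bigID (mem S)) /=.
    congr (_ * _).
      rewrite (eq_bigr (fun=> d ch1)) => [|j /andP[/andP[ji]]]; last first.
        by rewrite !inE ji /= ffunE (negbTE ji) => -> ->.
      rewrite (eq_bigl (mem S)) ?prodr_const // => j /=.
      case jS : (j \in S); rewrite ?andbF //.
      by have := fintype.subsetP sS j jS; rewrite !inE => /andP[-> ->].
    rewrite (eq_bigr (fun=> d ch2)) => [|j /andP[/andP[ji]]]; last first.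
      by rewrite !inE ji /= ffunE (negbTE ji) => -> /negbTE ->.
    rewrite (eq_bigl (mem (P :\ i :\: S))) ?prodr_const // => j /=.
    by rewrite !inE; case: (j == i); rewrite /= ?andbF // andbC.
  case: ifP => // sS; move: (sS); rewrite -inv => /eqP ->; rewrite eqxx andbT /= andbT.
  by rewrite mem_next // => /negbFE h; rewrite /F /slot_value h mul0r mulr0.
have cS (S : {set 'I_n}) : S \subset P :\ i -> (#|S| < #|P|)%N.
  move=> /subset_leq_card h; apply: leq_ltn_trans h _.
  by rewrite [X in (_ < X)%N](cardsD1 i P) iP add1n.
have Pgt : (0 < #|P|)%N by apply/card_gt0P; exists i.
have -> : slot_op a (d ch1) (d ch2) f #|P| = \sum_(k < #|P|.-1.+1) F k *+ 'C(#|P|.-1, k).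
  by rewrite /slot_op prednK.
(* Grouping the sets [S] by size yields the binomial coefficient; [inord] is faithful here because
   [#|S| < #|P|]. *)
rewrite (partition_big (fun S : {set 'I_n} => inord #|S| : 'I_(#|P|.-1.+1)) xpredT) //=.
apply: eq_bigr => k _.
have kk (S : {set 'I_n}) : S \subset P :\ i -> (inord #|S| == k) = (#|S| == k).
  move=> /cS h; apply/eqP/eqP => [<-|->]; last by rewrite inord_val.
  by rewrite inordK // prednK.
rewrite (eq_bigr (fun=> F k)); last by move=> S /andP[sS]; rewrite kk // => /eqP ->.
rewrite (eq_bigl (mem [set S : {set 'I_n} | S \subset P :\ i & #|S| == k])); last first.
  by move=> S; rewrite !inE; case sS: (S \subset _) => //=; rewrite kk.
by rewrite sumr_const cards_draws cPi.
Qed.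

End SlotExpectation.

(** * Linearity, symmetry and closed forms of the one-slot operator *)

Lemma sum_ord_delta (R : pzSemiRingType) (m c : nat) (F : nat -> R) : (c < m)%N ->
  \sum_(k < m) F k * (k == c :> nat)%:R = F c.
Proof.
move=> cm; rewrite (bigD1 (Ordinal cm)) //= eqxx mulr1 big1 ?addr0 // => k kc.
by rewrite (_ : (k == c :> nat) = false) ?mulr0 //; apply/negbTE.
Qed.

Section SlotOp.
Context {R : realType}.
Implicit Types (p q : R) (f g : nat -> R) (a : action).

Lemma slot_op_ch2 p q f m : slot_op ch2 p q f m = slot_op ch1 q p f m.
Proof.
rewrite /slot_op (reindex_inj rev_ord_inj) /=; apply: eq_bigr => k _.
have km : (k <= m.-1)%N by case: m k => [[]//|m] k; rewrite -ltnS.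
have -> : (m - k.+1)%N = (m.-1 - k)%N by case: m {km} k => [[]//|m] k; rewrite subSS.
rewrite bin_sub // subKn // [q ^+ k * _]mulrC; congr (_ * _ *+ _).
by rewrite /slot_value /= subKn // orbF !addn0 subnAC.
Qed.

Lemma ler_slot_op a p q f g m : 0 <= p -> 0 <= q ->
  (forall l, (l <= m)%N -> f l <= g l) -> slot_op a p q f m <= slot_op a p q g m.
Proof.
move=> p0 q0 fg; apply: ler_sum => k _; rewrite lerMn2r; apply/orP; right.
rewrite ler_wpM2l ?mulr_ge0 ?exprn_ge0 // ler_wpM2l //.
by apply: fg; rewrite -subnDA leq_subr.
Qed.

Lemma slot_op_sum a p q (I : Type) (r : seq I) (F : I -> nat -> R) m :
  slot_op a p q (fun l => \sum_(s <- r) F s l) m = \sum_(s <- r) slot_op a p q (F s) m.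
Proof.
rewrite /slot_op exchange_big; apply: eq_bigr => k _.
by rewrite /slot_value mulr_sumr mulr_sumr sumrMnl.
Qed.

Lemma eq_slot_op a p q f g m : f =1 g -> slot_op a p q f m = slot_op a p q g m.
Proof. by move=> fg; apply: eq_bigr => k _; rewrite /slot_value fg. Qed.

Lemma slot_op_cvg a p q (u : nat -> nat -> R) f m :
  (forall l, (l <= m)%N -> ((u N l : R) @[N --> \oo] --> (f l : R))%classic) ->
  (slot_op a p q (u N) m @[N --> \oo] --> slot_op a p q f m)%classic.
Proof.
move=> h; apply: cvg_big => [|k _]; first exact: add_continuous.
apply: cvgMn; apply: cvgMr; apply: cvgMr; apply: h.
by rewrite -subnDA leq_subr.
Qed.

(** The binomial weights sum to 1, so only the counts [k] for which somebody succeeds contribute a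
    correction to [f m]. *)
Lemma slot_opE a p q f m : p + q = 1 -> (0 < m)%N ->
  slot_op a p q f m = f m + \sum_(k < m)
    (p ^+ k * q ^+ (m.-1 - k) *+ 'C(m.-1, k)) * (slot_value f a m k - f m).
Proof.
move=> pq m0.
have e : \sum_(k < m) p ^+ k * q ^+ (m.-1 - k) *+ 'C(m.-1, k) = 1.
  have := exprDn q p m.-1; rewrite addrC pq expr1n prednK // => ->.
  by apply: eq_bigr => k _; rewrite mulrC.
rewrite -[X in X + _]mul1r -[X in X * _ + _]e.
rewrite mulr_suml -big_split /=; apply: eq_bigr => k _.
by rewrite mulrnAl; ring.
Qed.

(** Two counts matter: no other player on channel 1 (own success), or exactly one on channel 2 (she
    leaves). For [m = 2] they would coincide. *)
Lemma slot_op_ch1_ge3 p q f m : p + q = 1 -> (2 < m)%N ->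
  slot_op ch1 p q f m =
  (1 - q ^+ m.-1) * f m + m.-1%:R * q * p ^+ m.-2 * (f m.-1 - f m).
Proof.
case: m => [|[|[|j]]] // pq _; rewrite slot_opE //.
pose b k : R := p ^+ k * q ^+ (j.+2 - k) *+ 'C(j.+2, k).
rewrite (eq_bigr (fun k : 'I_j.+3 => - f j.+3 * (b k * (k == 0 :> nat)%:R)
   + (f j.+2 - f j.+3) * (b k * (k == j.+1 :> nat)%:R))); last first.
  move=> [k kj] _ /=; rewrite -/(b k) /slot_value /= orbF addn0 addn1.
  case: (eqVneq k 0%N) => [->|k0] /=.
    rewrite ?subn0 /=; ring.
  rewrite -lt0n in k0.
  case: (eqVneq k j.+1) => [->|kj1].
    rewrite (subSnn j.+1) /= subn0 subn1 /= ; ring.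
  rewrite (_ : (j.+2 - k == 1)%N = false); last by apply/eqP; lia.
  by rewrite eqSS (gtn_eqF k0) /= !subn0; ring.
rewrite big_split /= -!mulr_sumr !sum_ord_delta // /b.
rewrite subn0 bin0 expr0 subSnn binSn expr1 -mulr_natr /=.
by ring.
Qed.

(** One departure occurs when exactly one other player is on channel 1, or exactly one on channel 2.
    For [m = 3] both happen at once and two players leave, hence the bound on [m]. *)
Lemma slot_op_idle_ge4 p q f m : p + q = 1 -> (3 < m)%N ->
  slot_op idle p q f m =
  f m + m.-1%:R * (p * q ^+ m.-2 + q * p ^+ m.-2) * (f m.-1 - f m).
Proof.
case: m => [|[|[|[|j]]]] // pq _; rewrite slot_opE //.
pose b k : R := p ^+ k * q ^+ (j.+3 - k) *+ 'C(j.+3, k).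
rewrite (eq_bigr (fun k : 'I_j.+4 => (f j.+3 - f j.+4) * (b k * (k == 1 :> nat)%:R)
   + (f j.+3 - f j.+4) * (b k * (k == j.+2 :> nat)%:R))); last first.
  move=> [k kj] _ /=; rewrite -/(b k) /slot_value /= !addn0.
  case: (eqVneq k 1%N) => [->|k1] /=.
    by rewrite subSS subn0 /= subn0 /=; ring.
  case: (eqVneq k j.+2) => [->|kj1].
    by rewrite subSnn /= subn0 subn1 /=; ring.
  rewrite (_ : (j.+3 - k == 1)%N = false); last by apply/eqP; lia.
  by rewrite /= !subn0; ring.
rewrite big_split /= -!mulr_sumr !sum_ord_delta // /b.
rewrite bin1 subn1 subSnn binSn expr1 /= -[p * _ *+ _]mulr_natr -[p ^+ _ * q *+ _]mulr_natr.
by ring.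
Qed.

Lemma slot_op_ch1_2 p q f : slot_op ch1 p q f 2 = p * f 2%N.
Proof.
rewrite /slot_op big_ord_recl big_ord1 /slot_value /= !mul0r mulr0 mul0rn !mul1r add0r bin1 mulr1 mulr1n.
exact: erefl.
Qed.

Lemma slot_op_ch1_1 p q f : slot_op ch1 p q f 1 = 0.
Proof. by rewrite /slot_op big_ord1 /slot_value /=; ring. Qed.

Lemma slot_op_0 a p q f : slot_op a p q f 0 = 0.
Proof. by rewrite /slot_op big_ord0. Qed.

Lemma slot_op_ch1_cst p q m : p + q = 1 -> (0 < m)%N ->
  slot_op ch1 p q (fun=> 1) m = 1 - q ^+ m.-1.
Proof.
case: m => [|[|[|m]]] // pq _; first by rewrite slot_op_ch1_1 subrr.
  by rewrite slot_op_ch1_2 mulr1 /= expr1 -pq addrK.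
by rewrite slot_op_ch1_ge3 // subrr mulr0 addr0 mulr1.
Qed.

End SlotOp.

(** * Beliefs, survival probabilities and deviations *)

Definition pairing {R : realType} {n : nat} (i : 'I_n) (w : {set 'I_n} -> R)
    (f : nat -> R) : R :=
  \sum_(P : {set 'I_n} | i \in P) w P * f #|P|.

(* [live q s t m]: probability that a player who follows [q] from slot [t] on,
   when [m] players are pending, is still pending [s] slots later. *)
Fixpoint live {R : realType} (q : mprotocol R) (s t m : nat) : R :=
  if s is s'.+1 then
    q t ch1 * slot_op ch1 (q t ch1) (q t ch2) (live q s' t.+1) m +
    q t ch2 * slot_op ch2 (q t ch1) (q t ch2) (live q s' t.+1) m
  else 1.

Definition pure {R : realType} (a : action) : {ffun action -> R} :=
  [ffun b => (b == a)%:R].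

(** A one-shot deviation: histories of length [t] belong to the start of slot [t.+1], which is where
    [a] is forced. *)
Definition deviate_at {R : realType} (q : mprotocol R) (t : nat) (a : action) :
    strategy R :=
  fun hist => if size hist == t then pure a else q (size hist).+1.

Definition emptier_channel {R : realType} (q : mprotocol R) : strategy R :=
  fun hist => pure (if q (size hist).+1 ch1 <= q (size hist).+1 ch2 then ch1 else ch2).

Lemma pure_dist {R : realType} (a : action) : is_dist (pure a : {ffun action -> R}).
Proof.
split=> [b|]; first by rewrite ffunE ler0n.
rewrite (bigD1 a) //= ffunE eqxx big1 ?addr0 // => b ba.
by rewrite ffunE (negbTE ba).
Qed.

Lemma sum_pure {R : realType} (a : action) (F : action -> R) :
  \sum_b pure a b * F b = F a.
Proof.
rewrite (bigD1 a) //= ffunE eqxx mul1r big1 ?addr0 // => b ba.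
by rewrite ffunE (negbTE ba) mul0r.
Qed.

Section Game.
Context {R : realType} {n : nat} (q : mprotocol R) (i : 'I_n).
Hypothesis q_dist : forall t, (1 <= t)%N -> is_dist (q t).
Hypothesis q_idle : forall t, (1 <= t)%N -> q t idle = 0.
Implicit Types (w : {set 'I_n} -> R) (f g : nat -> R) (h : seq action).

Lemma q_ge0 t a : (1 <= t)%N -> 0 <= q t a.
Proof. by move=> /q_dist[]. Qed.

Lemma q_sum1 t : (1 <= t)%N -> q t ch1 + q t ch2 = 1.
Proof.
by move=> t1; have [_] := q_dist t1; rewrite sum_action q_idle // add0r.
Qed.

Lemma pend_massE w : pend_mass i w = pairing i w (fun=> 1).
Proof. by apply: eq_bigr => P _; rewrite mulr1. Qed.

Lemma pairingB w f g : pairing i w (fun m => f m - g m) = pairing i w f - pairing i w g.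
Proof. by rewrite /pairing -sumrB; apply: eq_bigr => P _; rewrite mulrBr. Qed.

Lemma pairingD w f g : pairing i w (fun m => f m + g m) = pairing i w f + pairing i w g.
Proof. by rewrite /pairing -big_split; apply: eq_bigr => P _; rewrite mulrDr. Qed.

Lemma pairingZ w c f : pairing i w (fun m => c * f m) = c * pairing i w f.
Proof. by rewrite /pairing mulr_sumr; apply: eq_bigr => P _; rewrite mulrCA. Qed.

Lemma pairing_sum w (N : nat) (F : nat -> nat -> R) :
  pairing i w (fun m => \sum_(0 <= s < N) F s m) = \sum_(0 <= s < N) pairing i w (F s).
Proof.
by rewrite /pairing exchange_big; apply: eq_bigr => P _; rewrite mulr_sumr.
Qed.

Lemma card_pending (P : {set 'I_n}) : i \in P -> (0 < #|P| <= n)%N.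
Proof.
move=> iP; apply/andP; split; first by apply/card_gt0P; exists i.
by have := max_card (mem P); rewrite card_ord.
Qed.

Lemma eq_pairing w f g : (forall m, (0 < m <= n)%N -> f m = g m) ->
  pairing i w f = pairing i w g.
Proof.
by move=> fg; apply: eq_bigr => P iP; rewrite fg ?card_pending.
Qed.

Lemma ler_pairing w f g : (forall P, 0 <= w P) ->
  (forall m, (0 < m <= n)%N -> f m <= g m) -> pairing i w f <= pairing i w g.
Proof.
move=> w0 fg; apply: ler_sum => P iP.
by rewrite ler_wpM2l ?fg ?card_pending.
Qed.

Lemma pairing_cvg w (u : nat -> nat -> R) f :
  (forall m, (m <= n)%N -> ((u N m : R) @[N --> \oo] --> (f m : R))%classic) ->
  (pairing i w (u N) @[N --> \oo] --> pairing i w f)%classic.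
Proof.
move=> h; apply: cvg_big => [|P _]; first exact: add_continuous.
by apply: cvgMr; apply: h; have := max_card (mem P); rewrite card_ord.
Qed.

(** Duality: a slot pushes the belief forward, equivalently pulls back functions of the number of
    pending players. All later arguments act on such functions only. *)
Lemma pairing_step t a w f : (1 <= t)%N ->
  pairing i (step q i t a w) f = pairing i w (slot_op a (q t ch1) (q t ch2) f).
Proof.
move=> t1; rewrite /pairing /step.
under eq_bigr do rewrite mulr_suml.
rewrite exchange_big; apply: eq_bigr => P iP.
rewrite -(slot_expectation _ iP) ?q_idle //.
rewrite (partition_big (next_pending P) (fun P' => i \in P')) //= mulr_sumr.
apply: eq_bigr => P' iP'; rewrite -mulrA mulr_suml; congr (_ * _).
rewrite [RHS](eq_bigl (fun x => next_pending P x == P')); last first.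
  by move=> x; rewrite andbC; case: eqP => // ->.
by apply: eq_bigr => x /eqP ->.
Qed.

Lemma step_ge0 t a w : (1 <= t)%N -> (forall P, 0 <= w P) -> forall P, 0 <= step q i t a w P.
Proof.
move=> t1 w0 P; apply: sumr_ge0 => P' _; rewrite mulr_ge0 //.
apply: sumr_ge0 => x _; apply: prodr_ge0 => j _.
by case: ifP => _; [|case: ifP => _]; rewrite ?ler0n ?q_ge0.
Qed.

Lemma hist_weight_rcons h a :
  hist_weight q i (rcons h a) = step q i (size h).+1 a (hist_weight q i h).
Proof.
rewrite /hist_weight -[(size h).+1]addn1.
elim: h 1%N (@init_weight R n) => [|b h IH] t w //=.
by rewrite IH addSnnS.
Qed.

Lemma hist_weight_ge0 h P : 0 <= hist_weight q i h P.
Proof.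
elim/last_ind: h P => [P|h a IH P]; first exact: ler0n.
by rewrite hist_weight_rcons; apply: step_ge0.
Qed.

Lemma pairing_nil f : pairing i (hist_weight q i [::]) f = f n.
Proof.
rewrite /pairing /hist_weight /= /init_weight (bigD1 [set: 'I_n]) ?inE //= eqxx mul1r.
rewrite cardsT card_ord.
by rewrite big1 ?addr0 // => P /andP[_ /negbTE ->]; rewrite mul0r.
Qed.

Lemma pairing_rcons h a f :
  pairing i (hist_weight q i (rcons h a)) f =
  pairing i (hist_weight q i h) (slot_op a (q (size h).+1 ch1) (q (size h).+1 ch2) f).
Proof. by rewrite hist_weight_rcons pairing_step. Qed.

Lemma surv_live (sigma : strategy R) s h w :
  (forall h', (size h <= size h')%N -> sigma h' = q (size h').+1) ->
  surv q i sigma s h w = pairing i w (live q s (size h).+1).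
Proof.
elim: s h w => [|s IH] h w hs /=; first by rewrite pend_massE.
rewrite hs // sum_action q_idle // mul0r add0r.
have e a : surv q i sigma s (rcons h a) (step q i (size h).+1 a w) =
    pairing i w (slot_op a (q (size h).+1 ch1) (q (size h).+1 ch2) (live q s (size h).+2)).
  rewrite IH ?size_rcons ?pairing_step // => h' /ltnW; exact: hs.
by rewrite !e -!pairingZ -pairingD.
Qed.

Lemma surv_deviate_at s h w a :
  surv q i (deviate_at q (size h) a) s.+1 h w =
  pairing i w (slot_op a (q (size h).+1 ch1) (q (size h).+1 ch2) (live q s (size h).+2)).
Proof.
rewrite /= /deviate_at eqxx sum_pure surv_live ?size_rcons ?pairing_step //.
by move=> h' hh'; rewrite gtn_eqF.
Qed.

Lemma surv_ge0 (sigma : strategy R) s h w : (forall h', is_dist (sigma h')) ->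
  (forall P, 0 <= w P) -> 0 <= surv q i sigma s h w.
Proof.
move=> hs; elim: s h w => [|s IH] h w w0 /=; first exact: sumr_ge0.
apply: sumr_ge0 => a _; rewrite mulr_ge0 //; first by have [] := hs h.
by apply: IH; apply: step_ge0.
Qed.

(** Each of the at most [n.-1] others takes the opposite channel with probability at least 1/2, so
    the chosen one is empty with probability at least [2^-1 ^+ n]. *)
Lemma pend_mass_step_pure t w : (1 <= t)%N -> (forall P, 0 <= w P) ->
  pend_mass i (step q i t (if q t ch1 <= q t ch2 then ch1 else ch2) w)
  <= (1 - 2^-1 ^+ n) * pend_mass i w.
Proof.
move=> t1 w0; rewrite !pend_massE pairing_step // -pairingZ.
apply: ler_pairing => // m /andP[m0 mn]; rewrite mulr1.
have half (x : R) : 2^-1 <= x -> 1 - x ^+ m.-1 <= 1 - 2^-1 ^+ n.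
  move=> hx; rewrite lerB //; apply: (@le_trans _ _ (2^-1 ^+ m.-1)).
    apply: ler_wiXn2l; rewrite ?invr_ge0 ?invf_le1 ?ler1n //.
    by apply: leq_trans (leq_pred _) mn.
  by apply: lerXn2r => //; rewrite nnegrE ?invr_ge0 // (le_trans _ hx).
have s1 := q_sum1 t1.
case: ifPn => [le12|]; first by rewrite slot_op_ch1_cst //; apply: half; lra.
rewrite -ltNge => lt21.
rewrite slot_op_ch2 slot_op_ch1_cst //; first by apply: half; lra.
by rewrite addrC.
Qed.

Lemma surv_emptier_channel s h w : (forall P, 0 <= w P) ->
  surv q i (emptier_channel q) s h w <= (1 - 2^-1 ^+ n) ^+ s * pend_mass i w.
Proof.
elim: s h w => [|s IH] h w w0 /=; first by rewrite mul1r.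
rewrite sum_pure (le_trans (IH _ _ _)) //; first exact: step_ge0.
rewrite exprSr -mulrA ler_wpM2l ?pend_mass_step_pure // exprn_ge0 // subr_ge0.
by rewrite exprn_ile1 // ?invr_ge0 // invf_le1 // ler1n.
Qed.

Lemma sum_surv_emptier_channel N h w : (forall P, 0 <= w P) ->
  \sum_(0 <= s < N) surv q i (emptier_channel q) s h w <= 2 ^+ n * pend_mass i w.
Proof.
move=> w0; have pm0 : 0 <= pend_mass i w by apply: sumr_ge0.
have n0 : (0 < n)%N by apply: leq_ltn_trans (ltn_ord i).
set rho : R := 1 - 2^-1 ^+ n.
have half : (2^-1 : R) ^+ n <= 2^-1.
  by rewrite -[X in _ <= X]expr1; apply: ler_wiXn2l; rewrite ?invr_ge0 ?invf_le1 ?ler1n.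
have half0 : (0 : R) < 2^-1 ^+ n by rewrite exprn_gt0 // invr_gt0.
have rho0 : 0 < rho by rewrite /rho; lra.
have rho1 : `|rho| < 1 by rewrite gtr0_norm // /rho; lra.
apply: (@le_trans _ _ (series (geometric (pend_mass i w) rho) N)).
  apply: ler_sum => s _; rewrite /geometric /= mulrC.
  by rewrite surv_emptier_channel.
apply: (le_trans (geometric_le_lim N pm0 rho0 rho1)).
by rewrite /rho opprB addrC subrK exprVn invrK mulrC.
Qed.

(** Brings the extended-real equilibrium inequality down to finite partial sums: the terms are
    nonnegative, and the elapsed time and the normalisation by [pmw] cancel. *)
Lemma equilibrium_bound (sigma : strategy R) h (M : R) : equilibrium n q ->
  (forall h', is_dist (sigma h')) -> 0 < pend_mass i (hist_weight q i h) ->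
  (forall N, \sum_(0 <= s < N) surv q i sigma s h (hist_weight q i h) <= M) ->
  forall N, pairing i (hist_weight q i h)
    (fun m => \sum_(0 <= s < N) live q s (size h).+1 m) <= M.
Proof.
move=> eq hs pm hM N; have := eq i h pm sigma hs; rewrite /cond_latency /=.
set w := hist_weight q i h in pm hM *; set pmw := pend_mass i w in pm *.
have w0 : forall P, 0 <= w P by exact: hist_weight_ge0.
rewrite leeD2lE // => le.
have term0 (tau : strategy R) s : (forall h', is_dist (tau h')) ->
    (0 <= (surv q i tau s h w / pmw)%:E)%E.
  by move=> tau_dist; rewrite lee_fin divr_ge0 ?(ltW pm) // surv_ge0.
have q_str : forall h', is_dist (proto_strategy q h') by move=> h'; exact: q_dist.
have : (\sum_(0 <= s < N) (surv q i (proto_strategy q) s h w / pmw)%:E <= (M / pmw)%:E)%E.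
  apply: (le_trans (nneseries_lim_ge _ _)) => [s _ _|]; first exact: term0.
  apply: (le_trans le); apply: lime_le; first by apply: is_cvg_nneseries => s _ _; exact: term0.
  apply: nearW => k; rewrite sumEFin lee_fin -mulr_suml ler_pM2r ?invr_gt0 //.
rewrite sumEFin lee_fin -mulr_suml ler_pM2r ?invr_gt0 // => le2.
apply: le_trans le2; rewrite pairing_sum le_eqVlt; apply/orP; left; apply/eqP.
by apply: eq_bigr => s _; rewrite surv_live.
Qed.

End Game.

(** * Positivity of the one-slot operator, and idling against transmitting *)

Section SlotOpPositivity.
Context {R : realType}.
Implicit Types (p q : R) (f : nat -> R).

Lemma slot_value_ch1_ge0 f m k : 0 <= f m -> 0 <= f m.-1 ->
  0 <= slot_value f ch1 m k.
Proof.
move=> fm fm1; rewrite /slot_value /= orbF addn1.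
case: (_ == 1)%N; first by rewrite mul0r.
by rewrite mul1r subn0; case: (_ == 1)%N; rewrite ?subn0 ?subn1.
Qed.

Lemma slot_op_ch1_ge0 p q f m : 0 <= p -> 0 <= q ->
  0 <= f m -> 0 <= f m.-1 -> 0 <= slot_op ch1 p q f m.
Proof.
move=> p0 q0 fm fm1; apply: sumr_ge0 => k _.
by rewrite mulrn_wge0 // mulr_ge0 ?slot_value_ch1_ge0 // mulr_ge0 ?exprn_ge0.
Qed.

Lemma slot_op_ch1_ge_term p q f m k : (k < m)%N -> 0 <= p -> 0 <= q ->
  0 <= f m -> 0 <= f m.-1 ->
  (p ^+ k * q ^+ (m.-1 - k) * slot_value f ch1 m k) *+ 'C(m.-1, k)
  <= slot_op ch1 p q f m.
Proof.
move=> km p0 q0 fm fm1; rewrite /slot_op (bigD1 (Ordinal km)) //= lerDl.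
apply: sumr_ge0 => l _.
by rewrite mulrn_wge0 // mulr_ge0 ?slot_value_ch1_ge0 // mulr_ge0 ?exprn_ge0.
Qed.

Lemma slot_op_ch1_gt0 p q f m : (1 < m)%N -> 0 < p -> 0 <= q ->
  0 < f m -> 0 <= f m.-1 -> 0 < slot_op ch1 p q f m.
Proof.
case: m => [|[|m]] // _ p0 q0 fm fm1.
(* The term in which everybody collides on channel 1. *)
apply: lt_le_trans (slot_op_ch1_ge_term (ltnSn m.+1) _ _ _ _) => //; try exact: ltW.
rewrite /slot_value /= subnn !addn1 binn mulr1n /= !subn0 mulr1 mul1r.
by rewrite mulr_gt0 ?exprn_gt0.
Qed.

Lemma slot_op_ch1_gt0_pred p q f m : (2 < m)%N -> 0 < p -> 0 < q ->
  0 <= f m -> 0 < f m.-1 -> 0 < slot_op ch1 p q f m.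
Proof.
case: m => [|[|[|m]]] // _ p0 q0 fm fm1.
have km : (m.+1 < m.+3)%N by [].
apply: lt_le_trans (slot_op_ch1_ge_term km _ _ _ _) => //; try exact: ltW.
rewrite /slot_value /= subSnn addn1 binSn /= subn0 subn1 mul1r expr1.
by rewrite pmulrn_rgt0 // mulr_gt0 // mulr_gt0 ?exprn_gt0.
Qed.

Lemma slot_op_ch1_0_1 f m : slot_op ch1 0 1 f m = 0.
Proof.
case: m => [|[|[|m]]]; rewrite ?slot_op_0 ?slot_op_ch1_1 ?slot_op_ch1_2 ?mul0r //.
rewrite slot_op_ch1_ge3 ?add0r // expr1n subrr mul0r add0r /= expr0n /=.
by rewrite mulr0 mul0r.
Qed.

Lemma slot_op_idleC p q f m : p + q = 1 -> (3 < m)%N ->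
  slot_op idle p q f m = slot_op idle q p f m.
Proof.
move=> pq m3; have qp : q + p = 1 by rewrite addrC.
by rewrite !slot_op_idle_ge4 // [p * _ + _]addrC.
Qed.

(** With [c = m.-1] and [E = f m.-1 - f m], idling beats channel 1 exactly when
    [q * f m < - (p * c * E)]. Indifference between the channels expresses [E] through [f m], after
    which the claim reduces to [q ^+ 2 < p ^+ 2]. *)
Lemma slot_op_idle_lt p q f m : p + q = 1 -> 0 < q -> q < p -> (3 < m)%N -> 0 < f m ->
  slot_op ch1 p q f m = slot_op ch2 p q f m ->
  slot_op idle p q f m < slot_op ch1 p q f m.
Proof.
case: m => [|[|[|[|m]]]] // pq q0 qp _ fm.
rewrite slot_op_ch2 !slot_op_ch1_ge3 ?slot_op_idle_ge4 //=; last by rewrite addrC.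
set E := f m.+3 - f m.+4; set c := m.+3%:R.
have p0 : 0 < p by apply: lt_trans qp.
have x0 : 0 < p ^+ m.+1 by rewrite exprn_gt0.
have y0 : 0 < q ^+ m.+1 by rewrite exprn_gt0.
have xy : q ^+ m.+1 < p ^+ m.+1 by rewrite ltrXn2r // ltW.
rewrite (exprS p m.+2) (exprS q m.+2) (exprS p m.+1) (exprS q m.+1).
move: (p ^+ m.+1) (q ^+ m.+1) x0 y0 xy => x y x0 y0 xy e.
have key : (p ^+ 2 * x - q ^+ 2 * y) * f m.+4 = q * (x - y) * (- (p * c * E)) by lra.
suff lt : q * f m.+4 < - (p * c * E).
  rewrite -subr_gt0.
  have -> : (1 - q * (q * y)) * f m.+4 + c * q * (p * x) * E -
    (f m.+4 + c * (p * (q * y) + q * (p * x)) * E) =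
    q * y * (- (p * c * E) - q * f m.+4) by ring.
  by rewrite mulr_gt0 ?mulr_gt0 // subr_gt0.
have qxy : 0 < q * (x - y) by rewrite mulr_gt0 // subr_gt0.
rewrite -(ltr_pM2l qxy) -key -subr_gt0.
have -> : (p ^+ 2 * x - q ^+ 2 * y) * f m.+4 - q * (x - y) * (q * f m.+4) =
  (p - q) * (p + q) * x * f m.+4 by ring.
by rewrite pq mulr1 !mulr_gt0 // subr_gt0.
Qed.

End SlotOpPositivity.

(** * Both channels are used in every slot of an equilibrium *)

Section Equilibrium.
Context {R : realType} {n : nat} (q : mprotocol R) (i : 'I_n).
Hypothesis n_gt4 : (4 < n)%N.
Hypothesis q_dist : forall t, (1 <= t)%N -> is_dist (q t).
Hypothesis q_idle : forall t, (1 <= t)%N -> q t idle = 0.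
Hypothesis q_eq : equilibrium n q.

Local Notation W h := (hist_weight q i h).
Local Notation slot a t := (slot_op a (q t ch1) (q t ch2)).

Let W_ge0 h P : 0 <= W h P. Proof. exact: hist_weight_ge0. Qed.
Let q0 t a : (1 <= t)%N -> 0 <= q t a. Proof. exact: q_ge0. Qed.
Let q1 t : (1 <= t)%N -> q t ch1 + q t ch2 = 1. Proof. exact: q_sum1. Qed.

(** While [i] keeps colliding on channel 1, at most one player leaves per slot, through channel 2.
    So only counts at least [n - tau] matter, and each of them above 1 has positive weight. *)
Lemma pairing_ch1_gt0 tau f m0 :
  (forall t, (1 <= t <= tau)%N -> 0 < q t ch1 /\ 0 < q t ch2) ->
  (forall m, (n <= m + tau)%N -> (m <= n)%N -> 0 <= f m) ->
  (1 < m0 <= n)%N -> (n <= m0 + tau)%N -> 0 < f m0 ->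
  0 < pairing i (W (nseq tau ch1)) f.
Proof.
elim: tau f m0 => [|tau IH] f m0 qpos f0 /andP[m1 mn] nm fm.
  rewrite pairing_nil (_ : n = m0) //; lia.
have -> : nseq tau.+1 ch1 = rcons (nseq tau ch1) ch1.
  by elim: tau {IH qpos f0 nm} => //= tau {1}->.
rewrite pairing_rcons // size_nseq.
have [p0 p1] : 0 < q tau.+1 ch1 /\ 0 < q tau.+1 ch2 by apply: qpos; rewrite ltnS leqnn.
have qpos' t : (1 <= t <= tau)%N -> 0 < q t ch1 /\ 0 < q t ch2.
  by move=> ht; apply: qpos; lia.
have g0 m : (n <= m + tau)%N -> (m <= n)%N -> 0 <= slot ch1 tau.+1 f m.
  by move=> h1 h2; apply: slot_op_ch1_ge0; [exact: ltW|exact: ltW|apply: f0; lia|apply: f0; lia].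
(* Either [m0] is already reachable one slot earlier and everybody collides, or it is reached from
   [m0.+1] by one departure on channel 2. *)
have [h|h] := leqP n (m0 + tau).
  apply: (IH _ m0) => //; first by rewrite m1.
  by apply: slot_op_ch1_gt0 => //; [exact: ltW|apply: f0; lia].
apply: (IH _ m0.+1) => //; [lia|lia|].
by apply: slot_op_ch1_gt0_pred => //; apply: f0; lia.
Qed.

Let pend_mass_ge0 h : 0 <= pend_mass i (W h).
Proof. by apply: sumr_ge0. Qed.

Lemma deviate_at_dist tau a h : is_dist (deviate_at q tau a h).
Proof. by rewrite /deviate_at; case: ifP => _; [exact: pure_dist|exact: q_dist]. Qed.

(** Transmitting on a channel that the others avoid succeeds at once. The protocol itself surely
    wastes the slot when all [n] players are pending, an event of positive weight after [tau]
    collisions on channel 1. *)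
Let empty_channel_absurd tau a :
  (forall t, (1 <= t <= tau)%N -> 0 < q t ch1 /\ 0 < q t ch2) ->
  (forall f m, slot a tau.+1 f m = 0) -> live q 1 tau.+1 n = 1 -> False.
Proof.
move=> qpos slot0 live1.
set h := nseq tau ch1.
have szh : size h = tau by rewrite size_nseq.
have pm0 : 0 < pend_mass i (W h).
  by rewrite pend_massE; apply: (@pairing_ch1_gt0 _ _ n) => //; lia.
have dev N : \sum_(0 <= s < N) surv q i (deviate_at q tau a) s h (W h) <= pend_mass i (W h).
  case: N => [|N]; first by rewrite big_geq // ltW.
  rewrite big_nat_recl // big1 ?addr0 // => s _.
  rewrite -szh surv_deviate_at // szh /pairing big1 // => P _.
  by rewrite slot0 mulr0.
(* Two terms of the partial sum suffice: the first already equals the cost of the deviation, the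
   second is positive. *)
have := equilibrium_bound q_dist q_idle q_eq (deviate_at_dist tau a) pm0 dev 2.
rewrite pairing_sum !big_nat_recl // big_geq // addr0 -pend_massE szh gerDl.
apply/negP; rewrite -ltNge; apply: (@pairing_ch1_gt0 _ _ n) => //; [|lia|lia|by rewrite live1].
move=> m _ _; rewrite addr_ge0 // mulr_ge0 ?q0 // ?slot_op_ch2 slot_op_ch1_ge0 ?q0 //.
Qed.

Lemma channels_used t : (1 <= t)%N -> 0 < q t ch1 /\ 0 < q t ch2.
Proof.
(* Strong induction, since positive weight of the collision history rests on both channels being
   used in all earlier slots. *)
case: t => // tau _; elim/ltn_ind: tau => tau IH.
have qpos t : (1 <= t <= tau)%N -> 0 < q t ch1 /\ 0 < q t ch2.
  by case: t => // t ht; apply: IH.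
have s1 := q1 (isT : (1 <= tau.+1)%N).
have n1 : n.-1 != 0%N by lia.
have n0 : (0 < n)%N by lia.
split; rewrite lt_def q0 // andbT; apply/eqP => e; rewrite e in s1.
  move: s1; rewrite add0r => s1.
  apply: (empty_channel_absurd (a := ch1) qpos) => [f m|].
    by rewrite e s1 slot_op_ch1_0_1.
  by rewrite /= e s1 mul0r add0r mul1r slot_op_ch2 slot_op_ch1_cst ?addr0 // expr0n (negbTE n1) subr0.
move: s1; rewrite addr0 => s1.
apply: (empty_channel_absurd (a := ch2) qpos) => [f m|].
  by rewrite e s1 slot_op_ch2 slot_op_ch1_0_1.
by rewrite /= e s1 mul0r addr0 mul1r slot_op_ch1_cst ?addr0 // expr0n (negbTE n1) subr0.
Qed.

(** * Finiteness of the expected latencies *)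

Definition latency_upto N t m := \sum_(0 <= s < N) live q s t m.
Definition latency t m : R := limn (fun N => latency_upto N t m).

Lemma live_ge0 s t m : (1 <= t)%N -> 0 <= live q s t m.
Proof.
elim: s t m => [|s IH] t m t1 //=.
by rewrite addr_ge0 // mulr_ge0 ?q0 // ?slot_op_ch2 slot_op_ch1_ge0 ?q0 ?IH.
Qed.

Lemma latency_uptoS N t m :
  latency_upto N.+1 t m =
  1 + (q t ch1 * slot ch1 t (latency_upto N t.+1) m
       + q t ch2 * slot ch2 t (latency_upto N t.+1) m).
Proof.
rewrite /latency_upto big_nat_recl // !slot_op_sum !mulr_sumr -big_split.
by congr (_ + _).
Qed.

Lemma latency_upto_homo t m : (1 <= t)%N ->
  {homo (fun N => latency_upto N t m) : N M / (N <= M)%N >-> N <= M}.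
Proof.
move=> t1 N M NM; rewrite /latency_upto (@big_cat_nat _ _ _ N 0 M) //= lerDl.
by apply: sumr_ge0 => s _; exact: live_ge0.
Qed.

(** From slot [n] on, every [m] between 2 and [n] has positive weight after collisions on channel 1.
    The deviation [emptier_channel] bounds the averaged latency; dividing by the weight of [m]
    bounds each one. *)
Let latency_cvgn_late t m : (n <= t)%N -> (m <= n)%N ->
  cvgn (fun N => latency_upto N t m).
Proof.
move=> nt mn; have t1 : (1 <= t)%N by lia.
suff [B hB] : exists B, forall N, latency_upto N t m <= B.
  apply: nondecreasing_is_cvgn; first exact: latency_upto_homo.
  by exists B => _ [N _ <-].
have [m1|m1] := leqP m 1.
  exists 1 => -[|N]; first by rewrite /latency_upto big_geq.
  rewrite latency_uptoS slot_op_ch2.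
  by case: m m1 {mn} => [|[|]] // _; rewrite ?slot_op_0 ?slot_op_ch1_1 !mulr0 !addr0.
pose h := nseq t.-1 ch1; have szh : size h = t.-1 by rewrite size_nseq.
have qpos t' : (1 <= t' <= t.-1)%N -> 0 < q t' ch1 /\ 0 < q t' ch2.
  by case/andP => t'1 _; exact: channels_used.
have pm0 : 0 < pend_mass i (W h).
  by rewrite pend_massE; apply: (@pairing_ch1_gt0 _ _ n) => //; lia.
have c0 : 0 < pairing i (W h) (fun l => (l == m)%:R).
  by apply: (@pairing_ch1_gt0 _ _ m) => //; [lia|lia|rewrite eqxx].
have e_dist h' : is_dist (emptier_channel q h') by exact: pure_dist.
exists (2 ^+ n * pend_mass i (W h) / pairing i (W h) (fun l => (l == m)%:R)) => N.
rewrite ler_pdivlMr //.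
apply: le_trans (equilibrium_bound q_dist q_idle q_eq e_dist pm0 _ N); last first.
  by move=> M; apply: sum_surv_emptier_channel.
rewrite szh prednK // -pairingZ; apply: ler_pairing => // l _.
case: eqP => [->|_]; rewrite ?mulr1 // mulr0.
by apply: sumr_ge0 => s _; exact: live_ge0.
Qed.

Lemma latency_cvgn t m : (1 <= t)%N -> (m <= n)%N -> cvgn (fun N => latency_upto N t m).
Proof.
(* Backward induction from slot [n]: convergence at [t.+1] passes to [t] through the one-slot
   recursion. *)
move=> t1 mn; have [d td] : exists d, (n <= t + d)%N by exists n; lia.
elim: d t t1 td m mn => [|d IH] t t1 td m mn.
  by apply: latency_cvgn_late => //; lia.
have h l : (l <= m)%N -> (latency_upto N t.+1 l @[N --> \oo] --> latency t.+1 l)%classic.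
  by move=> lm; apply: IH => //; lia.
suff : ([sequence latency_upto N.+1 t m]_N @ \oo --> 1 + (q t ch1 * slot ch1 t (latency t.+1) m
       + q t ch2 * slot ch2 t (latency t.+1) m))%classic.
  by rewrite (cvg_shiftS (fun N => latency_upto N t m)); apply: cvgP.
rewrite /=; under eq_fun do rewrite latency_uptoS.
by apply: cvgD; [exact: cvg_cst|apply: cvgD; apply: cvgMr; exact: slot_op_cvg].
Qed.

Lemma latencyE t m : (1 <= t)%N -> (m <= n)%N ->
  latency t m = 1 + (q t ch1 * slot ch1 t (latency t.+1) m
                     + q t ch2 * slot ch2 t (latency t.+1) m).
Proof.
move=> t1 mn; apply: cvg_lim => //; rewrite -(cvg_shiftS (fun N => latency_upto N t m)).
rewrite /=; under eq_fun do rewrite latency_uptoS.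
have h l : (l <= m)%N -> (latency_upto N t.+1 l @[N --> \oo] --> latency t.+1 l)%classic.
  by move=> lm; apply: latency_cvgn => //; lia.
by apply: cvgD; [exact: cvg_cst|apply: cvgD; apply: cvgMr; exact: slot_op_cvg].
Qed.

Lemma latency_upto_le N t m : (1 <= t)%N -> (m <= n)%N -> latency_upto N t m <= latency t m.
Proof.
move=> t1 mn; exact: (nondecreasing_cvgn_le (latency_upto_homo m t1) (latency_cvgn t1 mn)).
Qed.

Lemma latency_ge1 t m : (1 <= t)%N -> (m <= n)%N -> 1 <= latency t m.
Proof.
move=> t1 mn; apply: le_trans (latency_upto_le 1 t1 mn).
by rewrite /latency_upto big_nat1.
Qed.

(** * Indifference between the channels, and its reading for each number of pending players *)

Lemma latency_deviation h a : 0 < pend_mass i (W h) ->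
  pairing i (W h) (latency (size h).+1) <=
  pend_mass i (W h) + pairing i (W h) (slot a (size h).+1 (latency (size h).+2)).
Proof.
move=> pm0.
have slot_le N m : (m <= n)%N -> slot a (size h).+1 (latency_upto N (size h).+2) m <=
   slot a (size h).+1 (latency (size h).+2) m.
  move=> mn; apply: ler_slot_op; rewrite ?q0 // => l lm.
  by apply: latency_upto_le => //; lia.
have slot_le' N : pairing i (W h) (slot a (size h).+1 (latency_upto N (size h).+2)) <=
   pairing i (W h) (slot a (size h).+1 (latency (size h).+2)).
  by apply: ler_pairing => // m /andP[_ mn]; exact: slot_le.
have dev N : \sum_(0 <= s < N) surv q i (deviate_at q (size h) a) s h (W h) <=
    pend_mass i (W h) + pairing i (W h) (slot a (size h).+1 (latency (size h).+2)).
  case: N => [|N].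
    rewrite big_geq // addr_ge0 ?(ltW pm0) //; apply: le_trans (slot_le' 0%N).
    rewrite /pairing big1 // => P _.
    rewrite (_ : slot _ _ _ _ = 0) ?mulr0 // /slot_op big1 // => k _.
    by rewrite /slot_value /latency_upto big_geq // !mulr0 mul0rn.
  rewrite big_nat_recl // lerD2l; apply: le_trans (slot_le' N).
  under eq_bigr do rewrite surv_deviate_at //.
  rewrite -pairing_sum le_eqVlt; apply/orP; left; apply/eqP.
  by apply: eq_pairing => m _; rewrite slot_op_sum.
have bound := equilibrium_bound q_dist q_idle q_eq (deviate_at_dist (size h) a) pm0 dev.
have cv : (pairing i (W h) (latency_upto N (size h).+1) @[N --> \oo] -->
   pairing i (W h) (latency (size h).+1))%classic.
  by apply: pairing_cvg => m mn; exact: latency_cvgn.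
rewrite -(cvg_lim _ cv) //; apply: limr_le; first by apply: cvgP cv.
by apply: nearW => N; exact: bound.
Qed.

(** The equilibrium continuation is an average of [X ch1] and [X ch2] with positive weights, yet
    exceeds no [X a]. Histories of weight zero make every [X a] vanish. *)
Lemma channel_indifference h (X := fun a =>
    pairing i (W h) (slot a (size h).+1 (latency (size h).+2))) :
  X ch1 = X ch2 /\ X ch1 <= X idle.
Proof.
have [pm0|pm0] := eqVneq (pend_mass i (W h)) 0.
  suff X0 a : X a = 0 by rewrite !X0.
  rewrite /X /pairing big1 // => P iP.
  have /psumr_eq0P -> := pm0; rewrite ?mul0r // => P' _; exact: W_ge0.
have {}pm0 : 0 < pend_mass i (W h) by rewrite lt_def pm0 pend_mass_ge0.
have dev a := latency_deviation a pm0.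
have eV : pairing i (W h) (latency (size h).+1) =
    pend_mass i (W h) + (q (size h).+1 ch1 * X ch1 + q (size h).+1 ch2 * X ch2).
  rewrite pend_massE -!pairingZ -!pairingD.
  by apply: eq_pairing => m /andP[_ mn]; rewrite latencyE.
have D a : q (size h).+1 ch1 * X ch1 + q (size h).+1 ch2 * X ch2 <= X a.
  by have := dev a; rewrite eV lerD2l.
have [p1 p2] := channels_used (isT : (1 <= (size h).+1)%N).
have s1 := q1 (isT : (1 <= (size h).+1)%N).
have := D ch1; have := D ch2; have D0 := D idle.
have e2 : q (size h).+1 ch2 = 1 - q (size h).+1 ch1 by lra.
rewrite e2 in p2 D0 *; move=> D2 D1.
have h1 : X ch2 <= X ch1 by rewrite -(ler_pM2l p2); lra.
have h2 : X ch1 <= X ch2 by rewrite -(ler_pM2l p1); lra.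
have e : X ch1 = X ch2 by apply/eqP; rewrite eq_le h2.
by split=> //; rewrite -e in D0; lra.
Qed.

(* Idle histories are needed here: the beliefs produced by transmitting alone
   do not separate the possible numbers of pending players. *)
Lemma pairing_eq0 tau f : (forall h, size h = tau -> pairing i (W h) f = 0) ->
  forall m, (2 < m <= n)%N -> (n <= m + tau)%N -> f m = 0.
Proof.
elim: tau f => [|tau IH] f hf m /andP[m2 mn] nm.
  have := hf [::] erefl; rewrite pairing_nil (_ : n = m) //; lia.
have slot0 a m' : (2 < m' <= n)%N -> (n <= m' + tau)%N -> slot a tau.+1 f m' = 0.
  apply: IH => h szh; have := hf (rcons h a); rewrite size_rcons szh => /(_ erefl).
  by rewrite pairing_rcons // szh.
have [p1 p2] := channels_used (isT : (1 <= tau.+1)%N).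
have s1 := q1 (isT : (1 <= tau.+1)%N).
have key m' : (3 < m' <= n)%N -> (n <= m' + tau)%N -> f m' = 0 /\ f m'.-1 = 0.
  move=> /andP[m3 m'n] nm'.
  have hm : (2 < m' <= n)%N by rewrite m'n andbT ltnW.
  have := slot0 idle _ hm nm'; have := slot0 ch1 _ hm nm'; have := slot0 ch2 _ hm nm'.
  rewrite slot_op_ch2 slot_op_idle_ge4 // !slot_op_ch1_ge3 ?[_ ch2 + _]addrC //; try lia.
  move: (q tau.+1 ch1) (q tau.+1 ch2) p1 p2 s1 => a b a0 b0 ab.
  set A := a ^+ m'.-1; set B := b ^+ m'.-1.
  set A' := a ^+ m'.-2; set B' := b ^+ m'.-2; set c := m'.-1%:R.
  move=> e2 e1 e0.
  have AB : A + B < 1.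
    have lt1 (x y : R) : 0 < x -> 0 < y -> x + y = 1 -> x ^+ m'.-1 < x.
      move=> x0 y0 xy; rewrite -[X in _ < X]expr1 ltr_iXn2l //; [lia|lra].
    have := lt1 a b a0 b0 ab; have := lt1 b a b0 a0; rewrite addrC => /(_ ab).
    by rewrite -/A -/B; lra.
  (* Adding the two channel equations and subtracting the idle one cancels the difference
     [f m'.-1 - f m'] and leaves the factor [1 - A - B]. *)
  have f0 : f m' = 0.
    have : (1 - A - B) * f m' = 0 by lra.
    by move/eqP; rewrite mulf_eq0 => /orP[/eqP|/eqP //]; lra.
  split=> //; move: e1; rewrite f0 mulr0 add0r subr0 => /eqP.
  have c0 : 0 < c by rewrite ltr0n; lia.
  rewrite mulf_eq0 => /orP[|/eqP //].
  by rewrite gt_eqF // mulr_gt0 ?mulr_gt0 // exprn_gt0.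
(* [key] at [m'] also covers [m'.-1], so each slot of history extends the range down by one; [m = n]
   is taken from [key] at [n] itself. *)
have [/eqP e|ne] := boolP (m == n).
  by have [] := key m => //; lia.
have [] // := key m.+1; lia.
Qed.

(** In late slots [m = 3] is within reach of [pairing_eq0], and indifference there forces equality.
    In early slots all possible [m] are at least 4, and unequal probabilities would make idling
    strictly better for each of them. *)
Lemma channels_equiprobable t : (1 <= t)%N -> q t ch1 = q t ch2.
Proof.
case: t => // tau _; set V := latency tau.+2.
have s1 := q1 (isT : (1 <= tau.+1)%N).
have [p1 p2] := channels_used (isT : (1 <= tau.+1)%N).
have V1 m : (m <= n)%N -> 1 <= V m by move=> mn; exact: latency_ge1.
have eq12 m : (2 < m <= n)%N -> (n <= m + tau)%N ->
    slot ch1 tau.+1 V m = slot ch2 tau.+1 V m.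
  move=> hm nm; apply/eqP; rewrite -subr_eq0; apply/eqP.
  apply: (@pairing_eq0 tau (fun m => slot ch1 tau.+1 V m - slot ch2 tau.+1 V m)) => // h szh.
  have [e _] := channel_indifference h; rewrite szh in e.
  by rewrite pairingB e subrr.
have [n3|n3] := leqP n (3 + tau).
  have hm : (2 < 3 <= n)%N by lia.
  (* At [m = 3] the terms in [V 2 - V 3] have the same coefficient on both sides and cancel. *)
  have := eq12 3%N hm n3; rewrite slot_op_ch2 !slot_op_ch1_ge3 //=; last by rewrite addrC.
  rewrite !expr1 => e.
  have V3 : V 3%N != 0.
    by rewrite gt_eqF // (lt_le_trans ltr01) // V1 //; lia.
  have : (q tau.+1 ch1 - q tau.+1 ch2) * (q tau.+1 ch1 + q tau.+1 ch2) * V 3%N = 0.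
    by rewrite -subr_sqr; lra.
  by rewrite s1 mulr1 => /eqP; rewrite mulf_eq0 (negbTE V3) orbF subr_eq0 => /eqP.
(* After [tau] transmissions on channel 1 at least [n - tau] players are pending, so a strict gain
   for all those [m] survives averaging. *)
have no_idle a : (forall m, (n <= m + tau)%N -> (m <= n)%N ->
    slot idle tau.+1 V m < slot a tau.+1 V m) ->
    a = ch1 \/ a = ch2 -> False.
  move=> lt a12; have := channel_indifference (nseq tau ch1); rewrite size_nseq -/V.
  move=> [X12 X10].
  have : pairing i (W (nseq tau ch1)) (slot a tau.+1 V) <=
         pairing i (W (nseq tau ch1)) (slot idle tau.+1 V).
    by case: a12 => ->; rewrite -?X12.
  apply/negP; rewrite -ltNge -subr_gt0 -pairingB.
  apply: (@pairing_ch1_gt0 _ _ n) => [t /andP[t1 _]|m nm mn|||]; first exact: channels_used.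
  - by rewrite subr_ge0 ltW // lt.
  - lia.
  - lia.
  - by rewrite subr_gt0 lt //; lia.
have [lt|lt|//] := ltgtP (q tau.+1 ch1) (q tau.+1 ch2).
  case: (@no_idle ch2); last by right.
  move=> m nm mn; rewrite slot_op_ch2 slot_op_idleC //; last by lia.
  apply: slot_op_idle_lt => //; [by rewrite addrC|lia|exact: lt_le_trans (V1 m mn)|].
  by rewrite -slot_op_ch2 slot_op_ch2 -slot_op_ch2 -eq12 ?slot_op_ch2 //; lia.
case: (@no_idle ch1); last by left.
move=> m nm mn; apply: slot_op_idle_lt => //; [lia|exact: lt_le_trans (V1 m mn)|].
by rewrite eq12 //; lia.
Qed.

(** * Latencies under the uniform protocol, and the final contradiction *)

Let q_half t c : (1 <= t)%N -> c != idle -> q t c = 2^-1.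
Proof.
move=> t1 cn; have := q1 t1; have := channels_equiprobable t1.
by case: (action_cases c) cn => -> // _ e s; lra.
Qed.

Lemma live_stationary s t m : (1 <= t)%N -> live q s t.+1 m = live q s t m.
Proof.
elim: s t m => [//|s IH] t m t1 /=; rewrite !q_half //.
by congr (_ * _ + _ * _); apply: eq_slot_op => l; rewrite IH.
Qed.

Let V := latency 1.

Lemma latency_recursion m : (m <= n)%N -> V m = 1 + slot_op ch1 2^-1 2^-1 V m.
Proof.
move=> mn; rewrite /V latencyE // !q_half // slot_op_ch2.
have -> : slot_op ch1 2^-1 2^-1 (latency 2) m = slot_op ch1 2^-1 2^-1 (latency 1) m.
  apply: eq_slot_op => l; rewrite /latency; congr (limn _); apply/funext => N.
  by apply: eq_bigr => s _; exact: live_stationary.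
by lra.
Qed.

Lemma latency_closed_form m : (1 < m <= n)%N -> m%:R * V m = 2 ^+ m.
Proof.
elim: m => [|m IH] // /andP[m1 mn].
case: m m1 mn IH => [|[|m]] // _ mn IH.
  by have := latency_recursion mn; rewrite slot_op_ch1_2 expr2; lra.
have {IH} := IH _; rewrite -ltnS (ltn_trans _ mn) // => /(_ isT) IH.
have half1 : 2^-1 + 2^-1 = 1 :> R by lra.
have := latency_recursion mn; rewrite slot_op_ch1_ge3 //=.
rewrite -[_ * 2^-1 * _]mulrA -exprS !exprVn.
have u0 : (2 ^+ m.+2 : R) != 0 by rewrite expf_neq0 // pnatr_eq0.
move=> e; rewrite exprS; move: IH; rewrite -[m.+3]addn1 natrD => IH.
(* Clearing denominators turns the recursion into [m * V m = 2 ^+ m.-1 + m.-1 * V m.-1], in the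
   shifted variable. *)
have : 2 ^+ m.+2 * V m.+3 = 2 ^+ m.+2 + (2 ^+ m.+2 - 1) * V m.+3 + m.+2%:R * (V m.+2 - V m.+3).
  rewrite {1}e; field.
  by [].
rewrite addn1.
lra.
Qed.

Lemma not_equilibrium : False.
Proof.
have [_] := channel_indifference [::]; rewrite !pairing_nil /= !q_half //.
have half1 : 2^-1 + 2^-1 = 1 :> R by lra.
have e2 a : slot_op a 2^-1 2^-1 (latency 2) n = slot_op a 2^-1 2^-1 V n.
  apply: eq_slot_op => l; rewrite /V /latency; congr (limn _); apply/funext => N.
  by apply: eq_bigr => s _; exact: live_stationary.
rewrite !e2 slot_op_idle_ge4 ?slot_op_ch1_ge3 //; try lia.
have h1 := @latency_closed_form n; have h0 := @latency_closed_form n.-1.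
have Vn : 1 <= V n by exact: latency_ge1.
case: n n_gt4 Vn h0 h1 => [|[|[|[|[|k]]]]] // _ Vn /=.
rewrite ltnS leqnSn ltnSn => /(_ isT) h0 /(_ isT) h1.
rewrite (exprS _ k.+3).
have z0 : 0 < (2^-1 : R) ^+ k.+3 by rewrite exprn_gt0 // invr_gt0.
move: (2^-1 ^+ k.+3) z0 => z z0 le.
have {h0 h1} : (k.+4%:R + 1) * V k.+1.+4 = 2 * (k.+4%:R * V k.+4).
  by rewrite natr1 h1 h0 -exprS.
have c4 : 4 <= k.+4%:R :> R by rewrite ler_nat.
move: k.+4%:R c4 le => c c4 le e.
(* With [c = n - 1], idling being no better means [c * (V n - V n.-1) <= V n]. The closed form gives
   [(c + 1) * V n = 2 * c * V n.-1], hence [(c - 3) * V n <= 0], impossible for [n > 4]. *)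
have : z * (c * (V k.+1.+4 - V k.+4)) <= z * V k.+1.+4 by lra.
rewrite ler_pM2l // => le'.
have : (c - 3) * V k.+1.+4 <= 0 by lra.
by apply/negP; rewrite -ltNge mulr_gt0 //; lra.
Qed.

End Equilibrium.

Theorem theorem2 (R : realType) (n : nat) (q : mprotocol R) :
  (4 < n)%N ->
  (forall t : nat, (1 <= t)%N -> is_dist (q t)) ->
  (forall t : nat, (1 <= t)%N -> q t idle = 0) ->
  ~ equilibrium n q.
Proof.
move=> n_gt4 q_dist q_idle q_eq.
have n_gt0 : (0 < n)%N by apply: leq_trans n_gt4.
exact: (not_equilibrium (Ordinal n_gt0) n_gt4 q_dist q_idle q_eq).
Qed.
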